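(* Let $p>2$ be a prime number and let $G\neq\{e\}$ be a finite $p$-group. Then there exists a normal subgroup $N$ of $G$ such that $\log_p|G:N|\leq b(G)$ and $cl(N)\leq b(G)+1$.
   Context: For $x\in G$, the breadth is $b(x):=\log_p|G:Z_G(x)|$, where $Z_G(x)$ is the centralizer of $x$ in $G$, and $b(G):=\max_{g\in G}b(g)$. $cl(N)$ denotes the nilpotency class of $N$. *)

(* Defs.v *)
From mathcomp Require Import all_boot all_fingroup all_solvable.
Set Implicit Arguments. Unset Strict Implicit. Unset Printing Implicit Defensive.
Local Open Scope group_scope.

Definition breadth (p : nat) (gT : finGroupType) (G : {set gT}) (x : gT) : nat :=
  logn p #|G : 'C_G[x]|.

Definition group_breadth (p : nat) (gT : finGroupType) (G : {set gT}) : nat :=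
  \max_(g in G) breadth p G g.

(* Main.v *)
(** Let [c = n + 1] be the nilpotency class of [G], write [L_i] for the lower
    central series, and consider the [n] two-step centralizers
    [C_i = C_G(L_i / L_(i+2))], of index [p ^ k_i] with [k_i > 0].  An element
    outside [s] of the [C_i] has breadth at least [s], so every element of [G]
    lies in at least [e = n - b(G)] of them, and counting incidences gives
    [e <= \sum_i p ^ - k_i].  Let [N] be the intersection of [2 e] of the [C_i]
    of smallest index.  The lower central series of [N] descends at double
    speed through the selected levels, and skips at least [e] terms of that of
    [G], so [N] has class at most [c - e = b(G) + 1].  If [K] is the largest
    selected [k_i], the inequality [2 K + 1 <= 3 ^ k * (1 + (K - k))] turns the
    incidence count into [\sum_(i selected) k_i <= n - e = b(G)]. *)
Require Import Defs.
From mathcomp Require Import all_boot all_fingroup all_solvable.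
From mathcomp Require Import zify.
Local Open Scope group_scope.

(** Greedy choice: [J] grows by a minimizer of [k] outside it, and [K] is the last value added. *)
Lemma threshold_subset (I : finType) (k : I -> nat) (m : nat) :
  m <= #|I| ->
  exists K (J : {set I}),
    [/\ #|J| = m, forall i, k i < K -> i \in J & forall i, i \in J -> k i <= K].
Proof.
elim: m => [|m IHm ltmI].
  by move=> _; exists 0, set0; rewrite cards0; split=> // i; rewrite inE.
have [K [J [cardJ ltJ Jle]]] := IHm (ltnW ltmI).
have [i0 i0J]: exists i0, i0 \notin J.
  have /set0Pn[i0]: ~: J != set0 by rewrite -card_gt0 cardsCs setCK cardJ subn_gt0.
  by rewrite in_setC; exists i0.
case: (arg_minnP (P := fun i => i \notin J) k i0J) => i iJ imin.
exists (k i), (i |: J); split=> [|j ltji|j /setU1P[->|jJ]] //.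
- by rewrite cardsU1 iJ cardJ.
- rewrite in_setU1 orbC; case: (boolP (j \in J)) => //= jJ.
  by have := imin j jJ; rewrite leqNgt ltji.
- by apply: leq_trans (Jle j jJ) _; rewrite leqNgt; apply: contra iJ; apply: ltJ.
Qed.

(** Since [2 k + 1 <= 3 ^ k], it suffices that [2 (k + d) + 1 <= (1 + d) (2 k + 1)] for [d = K - k],
    which holds as [k > 0]. *)
Lemma threshold_leq_exp (K k p : nat) :
  0 < k -> 2 < p -> K.*2.+1 <= (1 + (K - k)) * p ^ k.
Proof.
move=> k_gt0 p_gt2; have le3p: (3 ^ k <= p ^ k)%N by rewrite leq_exp2r.
have lt3: (k.*2 < 3 ^ k)%N.
  elim: k k_gt0 {le3p} => // -[|k] IHk _ //.
  by have := IHk isT; rewrite [(3 ^ k.+2)%N]expnS; lia.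
apply: leq_trans (leq_mul (leqnn _) le3p).
have [leKk|/ltnW lekK] := leqP K k; first by lia.
by rewrite -{1}(subnKC lekK); nia.
Qed.

Lemma index_capg_leq (gT : finGroupType) (G H K : {group gT}) :
  H \subset G -> K \subset G -> #|G : H :&: K| <= #|G : H| * #|G : K|.
Proof.
move=> sHG sKG; rewrite -(Lagrange_index sHG (subsetIl H K)) leq_mul2l indexgI.
by rewrite subset_leq_card ?imsetS ?orbT.
Qed.

Lemma index_cent1_joing (gT : finGroupType) (H K : {group gT}) (x : gT) :
  K \subset H -> H \subset 'N(K) ->
  #|H : 'C[x]| = (#|H : K <*> 'C_H[x]| * #|K : 'C[x]|)%N.
Proof.
move=> sKH nKH; have nKC := subset_trans (subsetIl H 'C[x]) nKH.
have sKCH : K <*> 'C_H[x] \subset H by rewrite join_subG sKH subsetIl.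
rewrite -[LHS]indexgI -(Lagrange_index sKCH (joing_subr _ _)); congr (_ * _)%N.
apply/eqP; rewrite -(eqn_pmul2l (cardG_gt0 'C_H[x])) Lagrange ?joing_subr //.
rewrite /= norm_joinEr // -LagrangeMr mulnC.
by rewrite -[#|K : 'C_H[x]|]indexgI setIA (setIidPl sKH) indexgI.
Qed.

Section TwoStepCentralizers.

Variables (gT : finGroupType) (G : {group gT}).

(* Indices are shifted: [lcn_cent2 i] is the [C_(i+1)] of the header. *)
Definition lcn_cent2 (i : nat) : {group gT} :=
  'C_G('L_i.+1(G) / 'L_i.+3(G) | 'Q)%G.

Lemma sub_lcn_cent2 (i : nat) (A : {set gT}) :
  A \subset G -> (A \subset lcn_cent2 i) = ([~: 'L_i.+1(G), A] \subset 'L_i.+3(G)).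
Proof.
move=> sAG; rewrite subsetI sAG /= sub_astabQR 1?commGC //.
  exact: subset_trans sAG (lcn_norm _ _).
exact: subset_trans (lcn_sub _ _) (lcn_norm _ _).
Qed.

Lemma lcn_cent2_normal (i : nat) : lcn_cent2 i <| G.
Proof.
rewrite /normal subsetIl normsI ?normG //=.
apply: subset_trans (normal_norm (astab_normal _ _)).
by apply: actsQ; apply: lcn_norm.
Qed.

Lemma lcn_cent2_proper (i : nat) :
  nilpotent G -> i.+1 < nil_class G -> ~~ (G \subset lcn_cent2 i).
Proof.
move=> nilG lt_i; rewrite sub_lcn_cent2 // -lcnSn.
apply: contraL lt_i => sL; rewrite -leqNgt; apply/lcn_nil_classP => //.
move/forall_inP: nilG => /(_ 'L_i.+2(G)%G) /=.
by rewrite subsetI lcn_sub -lcnSn sL => /(_ isT)/eqP.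
Qed.

(** Modulo ['L_i.+3(G)], commutators with [x] vanish on ['L_i.+2(G)] and on the centralizer of [x];
    if these generated ['L_i.+1(G)], then [x] would lie in [lcn_cent2 i]. *)
Lemma notin_lcn_cent2 (i : nat) (x : gT) :
  x \in G -> x \notin lcn_cent2 i ->
  ~~ ('L_i.+1(G) \subset 'L_i.+2(G) <*> 'C_('L_i.+1(G))[x]).
Proof.
move=> Gx; apply: contra => sL; rewrite -sub1set sub_lcn_cent2 ?sub1set //.
have sCG : 'C_('L_i.+1(G))[x] \subset G.
  exact: subset_trans (subsetIl _ _) (lcn_sub _ _).
have nKC := subset_trans sCG (lcn_norm i.+2 G).
have nMG := lcn_norm i.+3 G.
rewrite gen_subG; apply/subsetP => _ /imset2P[h _ Hh /set1P-> ->].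
have: h \in 'L_i.+2(G) <*> 'C_('L_i.+1(G))[x] by apply: (subsetP sL).
rewrite norm_joinEr // => /mulsgP[k z Kk Cz ->].
have Gz := subsetP sCG z Cz.
have cxz : [~ z, x] = 1 by apply/eqP/commgP; case/setIP: Cz => _ /cent1P.
rewrite commMgJ cxz mulg1 memJ_norm ?(subsetP nMG) //.
by rewrite /= lcnSn mem_commg.
Qed.

(** Going down one term of the series splits off an index by [index_cent1_joing]; when [x] is
    outside [lcn_cent2], that index is a nontrivial power of [p]. *)
Lemma leq_logn_index_lcn (p n : nat) (x : gT) :
  p.-group G -> x \in G ->
  \sum_(i < n) (x \notin lcn_cent2 i) + logn p #|'L_n.+1(G) : 'C[x]|
    <= logn p #|G : 'C[x]|.
Proof.
move=> pG Gx; elim: n => [|n IHn]; first by rewrite big_ord0 add0n lcn1.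
apply: leq_trans IHn; rewrite big_ord_recr /= -addnA leq_add2l.
rewrite (index_cent1_joing _ _ _ _ (lcn_subS n.+1 G)) ?(subset_trans (lcn_sub _ _)) ?lcn_norm //.
rewrite lognM ?indexg_gt0 // leq_add2r.
have [//|ncx] := boolP (x \in _).
have := notin_lcn_cent2 _ _ Gx ncx; rewrite -indexg_gt1.
set m := #|_ : _| => m_gt1; have p_m : p.-nat m.
  by apply: pnat_dvd (dvdn_indexg _ _) (pgroupS (lcn_sub _ _) pG).
by rewrite lt0n; apply: contraTneq m_gt1 => lm0; rewrite -(part_pnat_id p_m) p_part lm0.
Qed.

(** [P] marks levels where [N] descends two terms at once. Such a jump may pass a second marked
    level, [i.+1], so each marked level is credited only half a term; hence the doubling. *)
Lemma lcn_skip (N : {group gT}) (P : pred nat) (m : nat) :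
  N \subset G -> (forall i, P i -> [~: 'L_i.+1(G), N] \subset 'L_i.+3(G)) ->
  exists2 i, 'L_m.+1(N) \subset 'L_i.+1(G) & m.*2 + \sum_(0 <= j < i) P j <= i.*2.
Proof.
move=> sNG skip; elim: m => [|m [i sLi le_mi]].
  by exists 0; rewrite ?lcn1 // big_geq.
have sLS : 'L_m.+2(N) \subset [~: 'L_i.+1(G), N] by rewrite lcnSn commSg.
have [Pi|nPi] := boolP (P i).
  exists i.+2; first exact: subset_trans sLS (skip i Pi).
  by rewrite !big_nat_recr //=; case: (P i); case: (P i.+1); lia.
exists i.+1; first by rewrite (subset_trans sLS) // lcnSn commgS.
by rewrite big_nat_recr //= (negPf nPi); lia.
Qed.

Lemma nil_class_lcn_skip (n e : nat) (N : {group gT}) (J : {set 'I_n}) :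
  nilpotent G -> nil_class G <= n.+1 -> N \subset G -> #|J| = e.*2 -> e <= n ->
  (forall i, i \in J -> N \subset lcn_cent2 i) ->
  nil_class N <= n.+1 - e.
Proof.
move=> nilG clG sNG cardJ le_en sNC; apply/lcn_nil_classP.
  exact: nilpotentS sNG nilG.
pose P i := [exists j in J, val j == i].
have skip i : P i -> [~: 'L_i.+1(G), N] \subset 'L_i.+3(G).
  by case/exists_inP => j Jj /eqP <-; rewrite -sub_lcn_cent2 ?sNC.
have [i sLi le_i] := lcn_skip N P (n.+1 - e) sNG skip.
apply/trivgP/(subset_trans sLi).
suff lt_ni : n < i.
  by have /lcn_nil_classP-> := leq_trans clG lt_ni.
(* If [i <= n], at most [n - i] of the [2 e] marked levels are missing from the sum, so
   [2 (n + 1 - e) + 2 e - (n - i) <= 2 i], that is [n + 2 <= i]. *)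
rewrite ltnNge; apply/negP => le_in.
have sumP : \sum_(0 <= j < n) P j = e.*2.
  rewrite -cardJ -sum1_card [RHS]big_mkcond big_mkord; apply: eq_bigr => j _.
  transitivity (nat_of_bool (j \in J)); last by case: (j \in J).
  congr nat_of_bool; apply/exists_inP/idP => [[j' Jj' /eqP/val_inj <-] // | Jj].
  by exists j.
have le_tail : \sum_(i <= j < n) P j <= n - i.
  rewrite -[leqRHS]muln1 -sum_nat_const_nat leq_sum // => j _; exact: leq_b1.
by move: sumP; rewrite (big_cat_nat _ (n := i)) //=; lia.
Qed.

End TwoStepCentralizers.

Lemma pgroup_index_logn (gT : finGroupType) (p : nat) (G H : {group gT}) :
  p.-group G -> #|G : H| = (p ^ logn p #|G : H|)%N.
Proof.
by move=> pG; rewrite -p_part part_pnat_id // (pnat_dvd (dvdn_indexg G H)).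
Qed.

Lemma logn_index_bigcap (gT : finGroupType) (p : nat) (G : {group gT})
    (I : finType) (J : {set I}) (H : I -> {group gT}) :
  prime p -> p.-group G -> (forall i, H i \subset G) ->
  logn p #|G : G :&: \bigcap_(i in J) H i| <= \sum_(i in J) logn p #|G : H i|.
Proof.
move=> p_pr pG sHG.
suff [K -> //] : exists2 K : {group gT}, G :&: \bigcap_(i in J) H i = K
    & logn p #|G : K| <= \sum_(i in J) logn p #|G : H i|.
elim/big_rec2: _ => [|i A s _ [K defK le_s]].
  by exists G; rewrite ?setIT // indexgg logn1.
exists (H i :&: K)%G; first by rewrite setICA defK.
apply: leq_trans (_ : logn p #|G : H i| + logn p #|G : K| <= _); last first.
  by rewrite leq_add2l.
rewrite -(leq_exp2l _ _ (prime_gt1 p_pr)) expnD -!pgroup_index_logn //.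
by apply: index_capg_leq; rewrite // -defK subsetIl.
Qed.

Theorem theorem2 (p : nat) (gT : finGroupType) (G : {group gT}) :
  prime p -> 2 < p -> p.-group G -> G :!=: 1 ->
  exists N : {group gT},
    [/\ N <| G,
        logn p #|G : N| <= group_breadth p G
      & nil_class N <= (group_breadth p G).+1].
Proof.
move=> p_pr p_gt2 pG _; set b := group_breadth p G.
have nilG := pgroup_nil pG.
have [le_cb|lt_bc] := leqP (nil_class G) b.+1.
  by exists G; rewrite normal_refl indexgg logn1.
pose n := (nil_class G).-1; pose e := n - b.
have clG : nil_class G = n.+1 by rewrite prednK // (leq_ltn_trans _ lt_bc).
have lt_bn : b < n by rewrite -ltnS -clG.
pose C i := lcn_cent2 gT G i; pose k (i : 'I_n) := logn p #|G : C i|.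
have sCG i : C i \subset G := normal_sub (lcn_cent2_normal _ G i).
have oC (i : 'I_n) : (#|C i| * p ^ k i)%N = #|G|.
  by rewrite -pgroup_index_logn // Lagrange.
have k_gt0 (i : 'I_n) : 0 < k i.
  rewrite lt0n; apply: contra (lcn_cent2_proper _ G i nilG _); last first.
    by rewrite clG ltnS.
  by move/eqP=> ki0; rewrite -indexg_eq1 (pgroup_index_logn _ p) // -/(k i) ki0.
have missed x : x \in G -> \sum_(i < n) (x \notin C i) <= b.
  move=> Gx; apply: leq_trans (leq_bigmax_cond _ Gx).
  rewrite /breadth indexgI.
  exact: leq_trans (leq_addr _ _) (leq_logn_index_lcn _ _ _ n x pG Gx).
(* Double count the pairs [(x, i)] with [x] in [C i]: each [x] misses at most [b] of the [n]
   subgroups. *)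
have incidence : e * #|G| <= \sum_(i < n) #|C i|.
  have -> : \sum_(i < n) #|C i| = \sum_(x in G) \sum_(i < n) (x \in C i).
    rewrite exchange_big; apply: eq_bigr => i _ /=.
    rewrite -sum1_card [LHS]big_mkcond [RHS]big_mkcond; apply: eq_bigr => x _.
    have [/(subsetP (sCG i))->|] //= := boolP (x \in C i).
    by case: (x \in G).
  rewrite mulnC -sum_nat_const; apply: leq_sum => x Gx.
  rewrite leq_subLR; apply: (@leq_trans (\sum_(i < n) 1)).
    by rewrite sum_nat_const card_ord muln1.
  apply: leq_trans (leq_add (missed x Gx) (leqnn _)).
  by rewrite -big_split; apply: leq_sum => i _ /=; case: (x \in C i).
have weigh K : e * K.*2.+1 <= \sum_(i < n) (1 + (K - k i)).
  rewrite -(leq_pmul2r (cardG_gt0 G)) big_distrl mulnAC.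
  apply: leq_trans (leq_mul incidence (leqnn _)) _.
  rewrite big_distrl; apply: leq_sum => i _ /=.
  rewrite -(oC i) mulnCA leq_mul2l.
  by rewrite threshold_leq_exp ?orbT.
(* At [K = 1] every [K - k i] is zero, so [weigh] gives [3 e <= n]. *)
have le_2e : e.*2 <= #|'I_n|.
  have := weigh 1%N; rewrite card_ord (eq_bigr (fun=> 1%N)); last first.
    by move=> i _; have := k_gt0 i; case: (k i).
  by rewrite sum_nat_const card_ord; lia.
have [K [J [cardJ ltJ Jle]]] := threshold_subset _ k _ le_2e.
have sum_k : \sum_(i in J) k i <= b.
  (* Outside [J] the truncated difference [K - k i] is zero because [k i >= K], so the sum over all
     levels in [weigh] is really a sum over [J]. *)
  have -> : \sum_(i in J) k i = e.*2 * K - \sum_(i < n) (K - k i).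
    rewrite -cardJ -sum_nat_const [in X in _ - X](bigID (mem J)) /=.
    rewrite [X in _ - (_ + X)]big1 => [|i nJi]; last first.
      by apply/eqP; rewrite subn_eq0 leqNgt; apply: contra nJi; apply: ltJ.
    have -> : \sum_(i in J) K = \sum_(i in J) (k i + (K - k i)).
      by apply: eq_bigr => i /Jle/subnKC.
    by rewrite addn0 big_split addnK.
  have := weigh K; rewrite big_split sum_nat_const card_ord /=; lia.
exists (G :&: \bigcap_(i in J) C i)%G; split.
- apply/andP; split; first exact: subsetIl.
  by rewrite normsI ?normG // norms_bigcap //; apply/bigcapsP => i _;
     apply: normal_norm (lcn_cent2_normal _ G i).
- by apply: leq_trans sum_k; apply: logn_index_bigcap.
- have -> : b.+1 = n.+1 - e by lia.
  apply: (nil_class_lcn_skip _ G n e _ J); rewrite ?clG ?subsetIl ?leq_subr //.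
  by move=> i Ji; apply: subset_trans (subsetIr _ _) (bigcap_inf _ Ji).
Qed.
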